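(* Let $(X,\Sigma,\lambda)$ be a positive measure space such that $L_1(X)^*=L_\infty(X)$ in the canonical way. A non-zero $f\in L_1(X)$ is a smooth point of $L_1(X)$ if and only if $f\ne0$ almost everywhere on $X$.
   Context: $\mathbb{K}$ is $\mathbb{R}$ or $\mathbb{C}$; $L_1(X)$ and $L_\infty(X)$ are the usual spaces of $\mathbb{K}$-valued functions (modulo a.e. equality) on $(X,\Sigma,\lambda)$. ''$L_1(X)^*=L_\infty(X)$ in the canonical way'' means that the map sending $h\in L_\infty(X)$ to the functional $f\mapsto\int_X hf\,d\lambda$ is an isometric isomorphism of $L_\infty(X)$ onto the continuous dual $L_1(X)^*$. For a normed space $\mathbb{X}$ over $\mathbb{K}$ with continuous dual $\mathbb{X}^*$ and non-zero $x\in\mathbb{X}$, $J(x):=\{\varphi\in\mathbb{X}^*:\|\varphi\|=1,\ \varphi(x)=\|x\|\}$; a non-zero $x$ is smooth if $J(x)$ is a singleton. *)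

(* Defs.v *)
From HB Require Import structures.
From mathcomp Require Import all_boot all_order all_algebra.
From mathcomp Require Import all_classical all_reals all_analysis.
From mathcomp Require Import measurable_realfun ess_sup_inf complex.

Set Implicit Arguments.
Unset Strict Implicit.
Unset Printing Implicit Defensive.

Import Order.TTheory GRing.Theory Num.Theory.
Import numFieldNormedType.Exports.

Local Open Scope classical_set_scope.
Local Open Scope ring_scope.

(* An interface covering R and R[i] uniformly; [ofR] is the embedding of R and
   [iunit] is the imaginary unit of R[i], and 0 for R. *)
Record rclike (R : realType) := RCLike {
  rc_sort :> numFieldType;
  re : rc_sort -> R;
  im : rc_sort -> R;
  ofR : R -> rc_sort;
  iunit : rc_sort;
  rc_eta : forall z, z = ofR (re z) + iunit * ofR (im z);
  reD : {morph re : z w / z + w};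
  imD : {morph im : z w / z + w};
  reM : forall z w, re (z * w) = re z * re w - im z * im w;
  imM : forall z w, im (z * w) = re z * im w + im z * re w;
  re_ofR : forall a, re (ofR a) = a;
  im_ofR : forall a, im (ofR a) = 0;
  rc_normE : forall z, `|z| = ofR (Num.sqrt (re z ^+ 2 + im z ^+ 2))
}.
Arguments ofR {R} K a : rename.
Arguments iunit {R} K : rename.

Section scalars.
Variable R : realType.

Program Definition real_scalars : rclike R :=
  @RCLike R (R : numFieldType) id (cst 0) id 0 _ _ _ _ _ _ _ _.
Next Obligation. by move=> z /=; rewrite mul0r addr0. Qed.
Next Obligation. by []. Qed.
Next Obligation. by move=> ? ? /=; rewrite addr0. Qed.
Next Obligation. by move=> ? ? /=; rewrite mulr0 subr0. Qed.
Next Obligation. by move=> ? ? /=; rewrite mulr0 mul0r addr0. Qed.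
Next Obligation. by []. Qed.
Next Obligation. by []. Qed.
Next Obligation. by move=> ? /=; rewrite expr0n/= addr0 sqrtr_sqr. Qed.

Local Open Scope complex_scope.

Program Definition complex_scalars : rclike R :=
  @RCLike R (R[i] : numFieldType) (@complex.Re R) (@complex.Im R)
    (fun a => a +i* 0) (0 +i* 1) _ _ _ _ _ _ _ _.
Next Obligation.
case=> a b; apply/eqP; rewrite eq_complex/=; apply/andP; split;
  by rewrite ?(mul0r, mulr0, mul1r, subr0, addr0, add0r).
Qed.
Next Obligation. by case=> [a b] [c d]. Qed.
Next Obligation. by case=> [a b] [c d]. Qed.
Next Obligation. by case=> [a b] [c d]. Qed.
Next Obligation. by case=> [a b] [c d]. Qed.
Next Obligation. by []. Qed.
Next Obligation. by []. Qed.
Next Obligation. by case. Qed.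

End scalars.

Section rclike_theory.
Variables (R : realType) (K : rclike R).
Implicit Types (z w : K) (a b : R).

Lemma ofR0 : ofR K 0 = 0.
Proof.
have re0 : re (0 : K) = 0 by have := reD (0 : K) 0; rewrite addr0 => /eqP;
  rewrite -subr_eq0 opprD addrA subrr sub0r oppr_eq0 => /eqP.
have im0 : im (0 : K) = 0 by have := imD (0 : K) 0; rewrite addr0 => /eqP;
  rewrite -subr_eq0 opprD addrA subrr sub0r oppr_eq0 => /eqP.
have := rc_normE (0 : K).
by rewrite normr0 re0 im0 expr0n/= addr0 sqrtr0.
Qed.

Lemma rc_ext z w : re z = re w -> im z = im w -> z = w.
Proof. by move=> rzw izw; rewrite (rc_eta z) (rc_eta w) rzw izw. Qed.

Lemma re0 : re (0 : K) = 0. Proof. by rewrite -ofR0 re_ofR. Qed.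
Lemma im0 : im (0 : K) = 0. Proof. by rewrite -ofR0 im_ofR. Qed.

Lemma ofRD a b : ofR K (a + b) = ofR K a + ofR K b.
Proof. by apply: rc_ext; rewrite ?reD ?imD ?re_ofR ?im_ofR ?addr0. Qed.

Lemma ofRM a b : ofR K (a * b) = ofR K a * ofR K b.
Proof.
by apply: rc_ext; rewrite ?reM ?imM ?re_ofR ?im_ofR ?mulr0 ?mul0r ?addr0 ?subr0.
Qed.

Lemma ofR_ge0 a : 0 <= a -> 0 <= ofR K a.
Proof.
move=> a0; have := rc_normE (ofR K a).
rewrite re_ofR im_ofR expr0n/= addr0 sqrtr_sqr (ger0_norm a0) => <-.
exact: normr_ge0.
Qed.

Lemma ofR_le a b : a <= b -> ofR K a <= ofR K b.
Proof.
move=> ab; have -> : b = a + (b - a) by rewrite addrC subrK.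
by rewrite ofRD lerDl ofR_ge0// subr_ge0.
Qed.

Lemma ofR_inj : injective (@ofR R K).
Proof. by move=> a b /(congr1 (@re R K)); rewrite !re_ofR. Qed.

Lemma re_normE z : re `|z| = Num.sqrt (re z ^+ 2 + im z ^+ 2).
Proof. by rewrite rc_normE re_ofR. Qed.

Lemma re_normK z : ofR K (re `|z|) = `|z|.
Proof. by rewrite re_normE -rc_normE. Qed.

Lemma re_norm_ge0 z : 0 <= re `|z|.
Proof. by rewrite re_normE sqrtr_ge0. Qed.

Lemma re_le z w : z <= w -> re z <= re w.
Proof.
rewrite -subr_ge0 => /ger0_norm wz; have := re_norm_ge0 (w - z).
by rewrite wz => h; rewrite -(subrK z w) reD lerDr.
Qed.

Lemma re1 : re (1 : K) = 1.
Proof.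
have := rc_normE (1 : K); rewrite normr1; set s := Num.sqrt _ => s1.
have ss : s * s = s by apply: (@ofR_inj); rewrite ofRM -s1 mulr1.
have s0 : s != 0.
  by apply/eqP => s0; have := oner_neq0 K; rewrite s1 s0 ofR0 eqxx.
by rewrite s1 re_ofR; apply: (mulfI s0); rewrite ss mulr1.
Qed.

Lemma re_norm0 : re `|0 : K| = 0. Proof. by rewrite normr0 re0. Qed.

Lemma re_normM z w : re `|z * w| = re `|z| * re `|w|.
Proof. by apply: ofR_inj; rewrite ofRM !re_normK normrM. Qed.

Lemma re_normD z w : re `|z + w| <= re `|z| + re `|w|.
Proof. by rewrite -reD re_le// ler_normD. Qed.

Lemma re_norm_eq0 z : re `|z| = 0 -> z = 0.
Proof. by move=> z0; apply/eqP; rewrite -normr_eq0 -re_normK z0 ofR0. Qed.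

End rclike_theory.

(* L_p spaces of K-valued functions; only p = 1 and p = +oo are needed. *)
Section Lp.
Context d (X : measurableType d) (R : realType) (K : rclike R).
Variables (mu : {measure set X -> \bar R}) (p : \bar R) (p1 : (1 <= p)%E).
Implicit Types f g : X -> K.

(* Equivalent to Borel measurability of f, K being R or R^2 topologically. *)
Definition kmeasurable f :=
  measurable_fun [set: X] (@re R K \o f) /\
  measurable_fun [set: X] (@im R K \o f).

Definition knorm_fun f : X -> R := fun x => re `|f x|.

Definition kLnorm f : \bar R := 'N[mu]_p[EFin \o knorm_fun f].

Lemma kmeasurable_norm f : kmeasurable f -> measurable_fun [set: X] (knorm_fun f).
Proof.
move=> [mr mi].
rewrite (_ : knorm_fun f =
  @Num.sqrt R \o ((fun x => re (f x) ^+ 2) \+ (fun x => im (f x) ^+ 2))); last first.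
  by apply/funext => x; rewrite /knorm_fun re_normE.
apply: measurableT_comp.
  by apply: continuous_measurable_fun; exact: sqrt_continuous.
by apply: measurable_funD; apply: measurable_funX.
Qed.

Lemma kmeasurable0 : kmeasurable (fun=> 0).
Proof. by split; exact: measurable_cst. Qed.

Lemma kmeasurable_lin (a : K) f g : kmeasurable f -> kmeasurable g ->
  kmeasurable (fun x => a * f x + g x).
Proof.
move=> [fr fi] [gr gi]; split.
- rewrite (_ : _ \o _ = (fun x => re a * re (f x) - im a * im (f x)) \+ (@re R K \o g)).
    apply: measurable_funD => //; apply: measurable_funB;
    exact: (measurable_funM (measurable_cst _)).
  by apply/funext => x /=; rewrite reD reM.
- rewrite (_ : _ \o _ = (fun x => re a * im (f x) + im a * re (f x)) \+ (@im R K \o g)).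
    apply: measurable_funD => //; apply: measurable_funD;
    exact: (measurable_funM (measurable_cst _)).
  by apply/funext => x /=; rewrite imD imM.
Qed.

Lemma le_Lnorm (u v : X -> R) :
  measurable_fun setT u -> measurable_fun setT v ->
  (forall x, 0 <= u x) -> (forall x, 0 <= v x) ->
  {ae mu, forall x, u x <= v x} ->
  ('N[mu]_p[EFin \o u] <= 'N[mu]_p[EFin \o v])%E.
Proof.
move=> mu_ mv u0 v0 uv.
rewrite unlock /Lnorm; case: p p1 => [r r1|_|//]; last first.
  case: ifPn => // _; apply: le_ess_sup; apply: filterS uv => x /=.
  by rewrite lee_fin !ger0_norm.
have r0 : 0 <= r by move: r1; rewrite lee_fin => /(le_trans _); apply.
apply: gt0_ler_poweR; rewrite ?invr_ge0//.
- by rewrite in_itv/= leey andbT; apply: integral_ge0 => x _; rewrite lee_fin powR_ge0.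
- by rewrite in_itv/= leey andbT; apply: integral_ge0 => x _; rewrite lee_fin powR_ge0.
apply: ae_ge0_le_integral => //.
- by move=> x _; exact: poweR_ge0.
- apply: (@measurableT_comp _ _ _ _ _ _ (fun x => x `^ r)%E) => //=.
    exact: measurable_poweR.
  exact/measurableT_comp/measurableT_comp.
- by move=> x _; exact: poweR_ge0.
- apply: (@measurableT_comp _ _ _ _ _ _ (fun x => x `^ r)%E) => //=.
    exact: measurable_poweR.
  exact/measurableT_comp/measurableT_comp.
apply: filterS uv => x uvx _ /=; rewrite lee_fin; apply: ge0_ler_powR => //.
by rewrite !ger0_norm.
Qed.

Lemma ae_eq_Lnorm (u v : X -> R) :
  measurable_fun setT u -> measurable_fun setT v ->
  (forall x, 0 <= u x) -> (forall x, 0 <= v x) ->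
  {ae mu, forall x, u x = v x} ->
  'N[mu]_p[EFin \o u]%E = 'N[mu]_p[EFin \o v]%E.
Proof.
move=> mu_ mv u0 v0 uv; apply/eqP; rewrite eq_le !le_Lnorm//.
- by apply: filterS uv => x ->.
- by apply: filterS uv => x ->.
Qed.

Lemma kLnormZ (a : K) f h : kmeasurable f -> kmeasurable h ->
  (kLnorm f < +oo)%E -> {ae mu, forall x, h x = a * f x} ->
  kLnorm h = ((re `|a|)%:E * kLnorm f)%E.
Proof.
move=> mf mh foo hE.
have mnf := kmeasurable_norm mf; have mnh := kmeasurable_norm mh.
have mnaf : measurable_fun setT (fun x => re `|a| * knorm_fun f x).
  exact: (measurable_funM (measurable_cst _)).
rewrite /kLnorm (@ae_eq_Lnorm (knorm_fun h) (fun x => re `|a| * knorm_fun f x))//.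
- have fL : knorm_fun f \in Lfun mu p by rewrite inE; apply/andP; split; rewrite inE.
  have := LnormZ (Lfun_Sub p1 fL) (re `|a|).
  by rewrite (ger0_norm (re_norm_ge0 a)) /= => <-.
- by move=> x; exact: re_norm_ge0.
- by move=> x; rewrite mulr_ge0 ?re_norm_ge0.
- by apply: filterS hE => x hx; rewrite /knorm_fun hx re_normM.
Qed.

Lemma kLnorm_lin (a : K) f g h :
  kmeasurable f -> kmeasurable g -> kmeasurable h ->
  (kLnorm f < +oo)%E -> {ae mu, forall x, h x = a * f x + g x} ->
  (kLnorm h <= (re `|a|)%:E * kLnorm f + kLnorm g)%E.
Proof.
move=> mf mg mh foo hE.
have mnf := kmeasurable_norm mf; have mng := kmeasurable_norm mg.
have mnaf : measurable_fun setT (fun x => re `|a| * knorm_fun f x).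
  exact: (measurable_funM (measurable_cst _)).
rewrite /kLnorm.
apply: (@le_trans _ _
  'N[mu]_p[EFin \o ((fun x => re `|a| * knorm_fun f x) \+ knorm_fun g)%R]%E).
  apply: le_Lnorm.
  - exact: kmeasurable_norm.
  - exact: measurable_funD.
  - by move=> x; exact: re_norm_ge0.
  - by move=> x; rewrite addr_ge0 ?mulr_ge0 ?re_norm_ge0.
  - apply: filterS hE => x hx; rewrite /knorm_fun hx.
    by rewrite (le_trans (re_normD _ _))// re_normM.
apply: (le_trans (eminkowski mu _ _ p1)) => //.
have fL : knorm_fun f \in Lfun mu p by rewrite inE; apply/andP; split; rewrite inE.
have := LnormZ (Lfun_Sub p1 fL) (re `|a|).
by rewrite (ger0_norm (re_norm_ge0 a)) /= => <-.
Qed.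

Lemma kLnorm0 : kLnorm (fun=> 0) = 0%E.
Proof.
rewrite /kLnorm (_ : _ \o _ = cst 0%E).
  by rewrite Lnorm0// gt_eqF// (lt_le_trans _ p1).
by apply/funext => x /=; rewrite /knorm_fun re_norm0.
Qed.

(* The proof of 1 <= p is carried by the type, as for LfunType. *)
Definition kLfun of (1 <= p)%E : {pred X -> K} :=
  mem [set f : X -> K | kmeasurable f /\ (kLnorm f < +oo)%E].

Lemma kLfunP f : f \in kLfun p1 <-> kmeasurable f /\ (kLnorm f < +oo)%E.
Proof. by split=> [/set_mem|/mem_set]. Qed.

Lemma kLfun_submod_closed : submod_closed (kLfun p1 : {pred X -> K^o}).
Proof.
split.
  by apply/kLfunP; split; [exact: kmeasurable0|rewrite kLnorm0 ltry].
move=> a f g /kLfunP[mf foo] /kLfunP[mg goo]; apply/kLfunP; split.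
  exact: kmeasurable_lin.
apply: (le_lt_trans (kLnorm_lin mf mg _ foo (aeW _ (fun x => erefl)))).
  exact: kmeasurable_lin.
rewrite lte_add_pinfty// lte_mul_pinfty// lee_fin.
exact: re_norm_ge0.
Qed.

HB.instance Definition _ :=
  GRing.isSubmodClosed.Build K (X -> K^o) (kLfun p1) kLfun_submod_closed.

Record kLfunType := KLfun { kLfun_val : X -> K^o ; _ : kLfun_val \in kLfun p1 }.
HB.instance Definition _ := [isSub for kLfun_val].
HB.instance Definition _ := [Choice of kLfunType by <:].
HB.instance Definition _ := [SubChoice_isSubLmodule of kLfunType by <:].

Lemma kLfun_valD (f g : kLfunType) x :
  kLfun_val (f + g) x = kLfun_val f x + kLfun_val g x.
Proof. by []. Qed.

Lemma kLfun_valN (f : kLfunType) x : kLfun_val (- f) x = - kLfun_val f x.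
Proof. by []. Qed.

Lemma kLfun_valZ a (f : kLfunType) x : kLfun_val (a *: f) x = a * kLfun_val f x.
Proof. by []. Qed.

Definition ae_zero : {pred kLfunType} :=
  mem [set f : kLfunType | {ae mu, forall x, kLfun_val f x = 0}].

Lemma ae_zeroP (f : kLfunType) :
  f \in ae_zero <-> {ae mu, forall x, kLfun_val f x = 0}.
Proof. by split=> [/set_mem|/mem_set]. Qed.

Lemma ae_zero_zmod_closed : zmod_closed ae_zero.
Proof.
split; first by apply/ae_zeroP; exact: aeW.
move=> f g /ae_zeroP f0 /ae_zeroP g0; apply/ae_zeroP.
move: f0 g0; apply: filterS2 => x fx gx.
by rewrite kLfun_valD kLfun_valN fx gx subr0.
Qed.

HB.instance Definition _ :=
  GRing.isZmodClosed.Build kLfunType ae_zero ae_zero_zmod_closed.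

(* f and g are identified when f - g vanishes almost everywhere; kLspace_fun
   picks a representative. *)
Definition kLspace : Type := Quotient.quot ae_zero.
HB.instance Definition _ := Choice.on kLspace.
HB.instance Definition _ := GRing.Zmodule.on kLspace.
HB.instance Definition _ := EqQuotient.on kLspace.

Local Open Scope quotient_scope.

Definition kLspace_fun (f : kLspace) : X -> K := kLfun_val (repr f).

Lemma kLspace_eqP (f g : kLfunType) :
  \pi_kLspace f = \pi_kLspace g <->
  {ae mu, forall x, kLfun_val f x = kLfun_val g x}.
Proof.
split.
  move/eqP; rewrite eqmodE => /ae_zeroP; apply: filterS => x.
  by rewrite kLfun_valD kLfun_valN => /eqP; rewrite subr_eq0 => /eqP.
move=> fg; apply/eqP; rewrite eqmodE; apply/ae_zeroP.
by apply: filterS fg => x; rewrite kLfun_valD kLfun_valN => ->; rewrite subrr.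
Qed.

Lemma kLspace_funP (f : kLfunType) :
  {ae mu, forall x, kLspace_fun (\pi_kLspace f) x = kLfun_val f x}.
Proof. by apply/kLspace_eqP; rewrite reprK. Qed.

Lemma kLspace_inj (f g : kLspace) :
  {ae mu, forall x, kLspace_fun f x = kLspace_fun g x} -> f = g.
Proof. by move=> /kLspace_eqP; rewrite !reprK. Qed.

Lemma kLspace_piD (f g : kLfunType) :
  \pi_kLspace (f + g) = \pi_kLspace f + \pi_kLspace g.
Proof. by rewrite [RHS](_ : _ = \pi_(Quotient.quot ae_zero) (f + g)) // !piE. Qed.

Definition kLspace_scale (a : K) (f : kLspace) : kLspace :=
  \pi_kLspace (a *: repr f).

Lemma kLspace_pi_scale a (f : kLfunType) :
  kLspace_scale a (\pi_kLspace f) = \pi_kLspace (a *: f).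
Proof.
apply/kLspace_eqP; have := kLspace_funP f; apply: filterS => x.
by rewrite /kLspace_fun !kLfun_valZ => ->.
Qed.

Lemma kLspace_scaleA a b (f : kLspace) :
  kLspace_scale a (kLspace_scale b f) = kLspace_scale (a * b) f.
Proof.
elim/quotW: f => f.
by rewrite (kLspace_pi_scale b f) (kLspace_pi_scale a) (kLspace_pi_scale _ f) scalerA.
Qed.

Lemma kLspace_scale1 : left_id 1 kLspace_scale.
Proof. by elim/quotW => f; rewrite kLspace_pi_scale scale1r. Qed.

Lemma kLspace_scaleDr : right_distributive kLspace_scale +%R.
Proof.
move=> a; elim/quotW => f; elim/quotW => g.
by rewrite -kLspace_piD !kLspace_pi_scale scalerDr kLspace_piD.
Qed.

Lemma kLspace_scaleDl (f : kLspace) : {morph kLspace_scale^~ f : a b / a + b}.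
Proof.
elim/quotW: f => f a b /=.
by rewrite !kLspace_pi_scale scalerDl kLspace_piD.
Qed.

HB.instance Definition _ := GRing.Zmodule_isLmodule.Build K kLspace
  kLspace_scaleA kLspace_scale1 kLspace_scaleDr kLspace_scaleDl.

Lemma kLspace_funD (f g : kLspace) :
  {ae mu, forall x, kLspace_fun (f + g) x = kLspace_fun f x + kLspace_fun g x}.
Proof.
have -> : f + g = \pi_kLspace (repr f + repr g) by rewrite kLspace_piD !reprK.
exact: kLspace_funP.
Qed.

Lemma kLspace_funZ a (f : kLspace) :
  {ae mu, forall x, kLspace_fun (a *: f) x = a * kLspace_fun f x}.
Proof. exact: kLspace_funP. Qed.

Lemma kLspace_fun0 : {ae mu, forall x, kLspace_fun 0 x = 0}.
Proof.
have -> : 0 = 0 *: (0 : kLspace) by rewrite scale0r.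
by apply: filterS (kLspace_funZ 0 0) => x ->; rewrite mul0r.
Qed.

(* The real number 'N[mu]_p[|f|], embedded in K because a normedModType K has a
   K-valued norm. *)
Definition kLspace_norm (f : kLspace) : K := ofR K (fine (kLnorm (kLspace_fun f))).

Lemma kLspace_mem (f : kLspace) : kmeasurable (kLspace_fun f) /\ (kLnorm (kLspace_fun f) < +oo)%E.
Proof. by apply/kLfunP; rewrite /kLspace_fun; case: (repr f). Qed.

Lemma kLnorm_fin (f : kLspace) : kLnorm (kLspace_fun f) \is a fin_num.
Proof. by rewrite ge0_fin_numE ?Lnorm_ge0//; have [] := kLspace_mem f. Qed.

Lemma fine_kLnormK (f : kLspace) :
  (fine (kLnorm (kLspace_fun f)))%:E = kLnorm (kLspace_fun f).
Proof. by rewrite fineK// kLnorm_fin. Qed.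

Lemma kLspace_ler_normD (f g : kLspace) :
  kLspace_norm (f + g) <= kLspace_norm f + kLspace_norm g.
Proof.
rewrite /kLspace_norm -ofRD; apply: ofR_le.
rewrite -lee_fin EFinD !fine_kLnormK.
have [mf foo] := kLspace_mem f; have [mg _] := kLspace_mem g.
have [mh _] := kLspace_mem (f + g).
rewrite (le_trans (@kLnorm_lin 1 _ _ _ mf mg mh foo _))//.
  by apply: filterS (kLspace_funD f g) => x ->; rewrite mul1r.
by rewrite normr1 re1 mul1e.
Qed.

Lemma kLspace_normrZ (a : K) (f : kLspace) :
  kLspace_norm (a *: f) = `|a| * kLspace_norm f.
Proof.
have [mf foo] := kLspace_mem f; have [mh _] := kLspace_mem (a *: f).
rewrite /kLspace_norm (kLnormZ mf mh foo (kLspace_funZ a f)).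
by rewrite fineM ?kLnorm_fin//= ofRM re_normK.
Qed.

Lemma kLspace_normr0_eq0 (f : kLspace) : kLspace_norm f = 0 -> f = 0.
Proof.
rewrite /kLspace_norm -(ofR0 K) => /ofR_inj f0.
have {}f0 : kLnorm (kLspace_fun f) = 0%E by rewrite -fine_kLnormK f0.
have [mf _] := kLspace_mem f.
apply: kLspace_inj.
have := Lnorm_eq0_eq0 _ (lt_le_trans lte01 p1) f0.
have mnf : measurable_fun setT (EFin \o knorm_fun (kLspace_fun f)).
  exact/measurable_EFinP/kmeasurable_norm.
move=> /(_ mnf); apply: filterS2 kLspace_fun0 => x x0 /(_ I)[] fx.
by rewrite x0; exact: re_norm_eq0.
Qed.

HB.instance Definition _ := Lmodule_isNormed.Build K kLspace
  kLspace_ler_normD kLspace_normrZ kLspace_normr0_eq0.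

End Lp.

Section L1_Linfty.
Context d (X : measurableType d) (R : realType) (K : rclike R).
Variable mu : {measure set X -> \bar R}.

Definition L1 : normedModType K := @kLspace d X R K mu 1%E (lexx 1%E).
Definition Linfty : normedModType K := @kLspace d X R K mu +oo%E (leey 1%E).

Lemma L1_normE (f : L1) :
  `|f| = ofR K (fine (\int[mu]_x (re `|kLspace_fun f x|)%:E)).
Proof.
rewrite [LHS](_ : _ = kLspace_norm f)// /kLspace_norm /kLnorm Lnorm1.
congr (ofR K (fine _)); apply: eq_integral => x _ /=.
by rewrite ger0_norm ?re_norm_ge0.
Qed.

Lemma Linfty_normE (h : Linfty) : (0 < mu [set: X])%E ->
  `|h| = ofR K (fine (ess_sup mu (fun x => (re `|kLspace_fun h x|)%:E))).
Proof.
move=> mu0; rewrite [LHS](_ : _ = kLspace_norm h)// /kLspace_norm /kLnorm unlock.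
rewrite mu0; congr (ofR K (fine (ess_sup mu _))); apply/funext => x /=.
by rewrite /knorm_fun ger0_norm ?re_norm_ge0.
Qed.

Definition kintegral (f : X -> K) : K :=
  ofR K (\int[mu]_x re (f x)) + iunit K * ofR K (\int[mu]_x im (f x)).

End L1_Linfty.

Section dual.
Variables (R : realType) (K : rclike R) (V : normedModType K).
Implicit Types (phi : V -> K^o) (x : V).

Definition dual : set (V -> K^o) :=
  [set phi | linear phi /\ continuous phi].

(* The operator norm, embedded in K like the norm of a normedModType K. *)
Definition dual_norm phi : K :=
  ofR K (sup [set re `|phi x| | x in [set x : V | `|x| <= 1]]).

(* The set J(x). *)
Definition norming x : set (V -> K^o) :=
  [set phi | [/\ dual phi, dual_norm phi = 1 & phi x = `|x|]].

Definition smooth_point x := x != 0 /\ exists phi, norming x = [set phi].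

End dual.

Section canonical_duality.
Context d (X : measurableType d) (R : realType) (K : rclike R).
Variable mu : {measure set X -> \bar R}.

(* Changing representatives changes the integrand on a null set only. *)
Definition canonical_map (h : Linfty K mu) : L1 K mu -> K^o :=
  fun f => kintegral mu (fun x => kLspace_fun h x * kLspace_fun f x).

(* set_bij includes the claim that canonical_map lands in the dual. *)
Definition L1_dual_is_Linfty : Prop :=
  [/\ linear canonical_map,
      set_bij [set: Linfty K mu] (@dual R K (L1 K mu)) canonical_map &
      forall h, dual_norm (canonical_map h) = `|h|].

End canonical_duality.

(* Main.v *)
Require Import Defs.
From HB Require Import structures.
From mathcomp Require Import all_boot all_order all_algebra.
From mathcomp Require Import all_classical all_reals all_analysis.
From mathcomp Require Import measurable_realfun ess_sup_inf ring.

Set Implicit Arguments.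
Unset Strict Implicit.
Unset Printing Implicit Defensive.

Import Order.TTheory GRing.Theory Num.Theory.
Import numFieldNormedType.Exports.

Local Open Scope classical_set_scope.
Local Open Scope ring_scope.

(** Under the duality, the functionals norming [f] are the [canonical_map h]
    with [`|h| = 1] and [\int h f = \int |f|].  Since [|h f| <= |f|] almost
    everywhere, equality of the integrals forces [h f = |f|] almost everywhere:
    first the real parts agree with [|f|], and a scalar whose real part is as
    large as its modulus equals that modulus.  Conversely, [h f = |f|] almost
    everywhere gives the equality of the integrals.  This equivalence is
    [canonical_map_attains_norm].

    So [h] is prescribed, as [|f| / f], exactly where [f] does not vanish.  If
    [f] vanishes only on a null set, [h] is determined almost everywhere, and
    there is a single norming functional.  In general, extending [|f| / f] by a
    unimodular constant [c] on the zero set of [f] (this is [phase c]) gives a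
    norming functional for every [c].  When [f] is smooth, the ones for [c = 1]
    and [c = -1] coincide; as the canonical map is injective, [1 = -1] almost
    everywhere on the zero set of [f], which is therefore null.

    The existence of norming functionals and their continuity both come from
    the duality assumption, so the Hahn-Banach theorem is not invoked. *)

(** * Scalars with prescribed modulus and phase *)

Section scalar_phase.
Variables (R : realType) (K : rclike R).
Implicit Types (c w z : K).

Lemma im_norm z : im `|z| = 0.
Proof. by rewrite rc_normE im_ofR. Qed.

Lemma ofR1 : ofR K 1 = 1.
Proof. by rewrite -(normr1 K) -re_normK normr1 re1. Qed.

Lemma re_norm_sqr z : re `|z| ^+ 2 = re z ^+ 2 + im z ^+ 2.
Proof. by rewrite re_normE sqr_sqrtr// addr_ge0 ?sqr_ge0. Qed.

Lemma re_norm_eq0E z : (re `|z| == 0) = (z == 0).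
Proof.
by apply/eqP/eqP => [/re_norm_eq0//|->]; exact: re_norm0.
Qed.

Lemma norm_re_le z : `|re z| <= re `|z|.
Proof.
rewrite -(@ler_pXn2r _ 2) ?nnegrE ?re_norm_ge0//.
by rewrite re_norm_sqr real_normK ?num_real// lerDl sqr_ge0.
Qed.

(** In R[i] the first factor vanishes, in R the second one; comparing real parts
    in the decomposition of [z] treats both cases at once. *)
Lemma re_iunit_im z : re (iunit K) * im z = 0.
Proof.
have := congr1 (@re R K) (rc_eta z).
rewrite reD reM !re_ofR im_ofR mulr0 subr0 => /eqP.
by rewrite -subr_eq0 opprD addrA subrr sub0r oppr_eq0 => /eqP.
Qed.

(** The squares of the real and imaginary parts add up to that of the modulus,
    so a real part equal to the modulus leaves nothing for the imaginary part. *)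
Lemma re_eq_norm z : re z = re `|z| -> z = `|z|.
Proof.
move=> zE; apply: rc_ext; rewrite // im_norm; apply/eqP.
by have /eqP := re_norm_sqr z; rewrite -zE addrC -subr_eq subrr eq_sym sqrf_eq0.
Qed.

(** The conjugate of the sign of [z].  The value [c] at 0 is a parameter because
    the different ways of filling it in are what makes several functionals norm
    the same vector. *)
Definition phase c z := if z == 0 then c else `|z| / z.

Lemma phase_mul c z : phase c z * z = `|z|.
Proof.
rewrite /phase; have [->|z0] := eqVneq z 0; first by rewrite mulr0 normr0.
by rewrite divfK.
Qed.

Lemma norm_phase c z : `|c| = 1 -> `|phase c z| = 1.
Proof.
rewrite /phase; have [//|z0 _] := eqVneq z 0.
by rewrite normrM normfV normr_id divff// normr_eq0.
Qed.

(** Dividing by [z] is multiplying by its conjugate over [`|z| ^+ 2].  An [rclike]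
    has no conjugation, so the parts of [w] are found by solving the two real
    linear equations contained in [w * z = `|z|]; these formulas serve to prove
    that [phase] preserves measurability. *)
Lemma re_im_phase_factor w z : z != 0 -> w * z = `|z| ->
  re w = re z / re `|z| /\ im w = - (im z / re `|z|).
Proof.
move=> z0 wz; have n0 : re `|z| != 0 by rewrite re_norm_eq0E.
have := congr1 (@re R K) wz; have := congr1 (@im R K) wz.
rewrite im_norm imM reM => /eqP; rewrite addrC addr_eq0 => /eqP wi wr.
have nn : re z * re z + im z * im z = re `|z| * re `|z|.
  by rewrite -!expr2 re_norm_sqr.
have rw : re w * re `|z| = re z.
  by apply: (mulIf n0); rewrite -mulrA -nn -wr; ring: wi.
have iw : im w * re `|z| = - im z.
  by apply: (mulIf n0); rewrite -mulrA -nn -wr; ring: wi.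
by split; apply: (mulIf n0); rewrite ?mulNr divfK.
Qed.

Lemma re_phase c z :
  re (phase c z) = if re `|z| == 0 then re c else re z / re `|z|.
Proof.
rewrite re_norm_eq0E; have [z0|z0] := eqVneq z 0; first by rewrite /phase z0 eqxx.
by have [] := re_im_phase_factor z0 (phase_mul c z).
Qed.

Lemma im_phase c z :
  im (phase c z) = if re `|z| == 0 then im c else - (im z / re `|z|).
Proof.
rewrite re_norm_eq0E; have [z0|z0] := eqVneq z 0; first by rewrite /phase z0 eqxx.
by have [] := re_im_phase_factor z0 (phase_mul c z).
Qed.

End scalar_phase.

(** * Measurability of the phase *)

Section measurable_phase.
Context d (X : measurableType d) (R : realType) (K : rclike R).
Implicit Types f g : X -> K.

Lemma measurable_knormV f :
  kmeasurable f -> measurable_fun setT (fun x => (knorm_fun f x)^-1).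
Proof.
(* The real power with exponent -1 is measurable on the whole line and agrees
   with the inverse on nonnegative numbers, 0 included. *)
move=> mf; rewrite (_ : (fun x => _) = (@powR R ^~ (-1)) \o knorm_fun f).
  exact: measurableT_comp (kmeasurable_norm mf).
by apply/funext => x /=; rewrite powR_inv1 ?re_norm_ge0.
Qed.

Lemma kmeasurable_mul f g :
  kmeasurable f -> kmeasurable g -> kmeasurable (fun x => f x * g x).
Proof.
move=> [fr fi] [gr gi]; split.
- rewrite (_ : _ \o _ = (fun x => re (f x) * re (g x) - im (f x) * im (g x))).
    by apply: measurable_funB; apply: measurable_funM.
  by apply/funext => x /=; rewrite reM.
- rewrite (_ : _ \o _ = (fun x => re (f x) * im (g x) + im (f x) * re (g x))).
    by apply: measurable_funD; apply: measurable_funM.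
  by apply/funext => x /=; rewrite imM.
Qed.

Lemma kmeasurable_phase c f :
  kmeasurable f -> kmeasurable (fun x => phase c (f x)).
Proof.
move=> mf; have mn := kmeasurable_norm mf; have [mr mi] := mf.
have m0 : measurable_fun setT (fun x => knorm_fun f x == 0).
  by apply: measurable_fun_eqr => //; exact: measurable_cst.
split.
- rewrite (_ : _ \o _ = (fun x => if knorm_fun f x == 0 then re c
      else re (f x) * (knorm_fun f x)^-1)).
    apply: measurable_fun_ifT => //.
    by apply: measurable_funM => //; exact: measurable_knormV.
  by apply/funext => x /=; rewrite re_phase.
- rewrite (_ : _ \o _ = (fun x => if knorm_fun f x == 0 then im c
      else - (im (f x) * (knorm_fun f x)^-1))).
    apply: measurable_fun_ifT => //; apply: measurableT_comp => //.
    by apply: measurable_funM => //; exact: measurable_knormV.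
  by apply/funext => x /=; rewrite im_phase.
Qed.

End measurable_phase.

(** * Integrals of scalar functions *)

Section kintegral_norm.
Context d (X : measurableType d) (R : realType) (K : rclike R).
Variable mu : {measure set X -> \bar R}.
Implicit Types f : X -> K.

Lemma ae_eq_Rintegral (u v : X -> R) :
  measurable_fun setT u -> measurable_fun setT v ->
  {ae mu, forall x, u x = v x} -> \int[mu]_x u x = \int[mu]_x v x.
Proof.
move=> mu_ mv uv; rewrite /Rintegral; congr fine.
apply: ae_eq_integral => //; [exact/measurable_EFinP|exact/measurable_EFinP|].
by apply: filterS uv => x ->.
Qed.

Lemma kintegral_ae_norm f (g : X -> K) : kmeasurable f -> kmeasurable g ->
  {ae mu, forall x, f x = `|g x|} ->
  kintegral mu f = ofR K (\int[mu]_x re `|g x|).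
Proof.
move=> [fr fi] mg fn; have mn := kmeasurable_norm mg.
rewrite /kintegral (@ae_eq_Rintegral (fun x => im (f x)) (cst 0))//; last first.
  by apply: filterS fn => x ->; rewrite im_norm.
rewrite Rintegral_cst// mul0r ofR0 mulr0 addr0; congr ofR.
by apply: ae_eq_Rintegral => //; apply: filterS fn => x ->.
Qed.

(** If [iunit K] has a nonzero real part, then all imaginary parts are 0 by
    [re_iunit_im], and the second integral contributes nothing either way. *)
Lemma re_kintegral f : re (kintegral mu f) = \int[mu]_x re (f x).
Proof.
rewrite reD reM !re_ofR !im_ofR mulr0 subr0.
have [->|i0] := eqVneq (re (iunit K)) 0; first by rewrite mul0r addr0.
rewrite (@eq_Rintegral _ _ _ mu _ (cst 0) (fun x => im (f x))).
  by rewrite Rintegral_cst// mul0r mulr0 addr0.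
move=> x _ /=; apply/eqP; move: (re_iunit_im (f x)) => /eqP.
by rewrite mulf_eq0 (negbTE i0).
Qed.

(** The equality case of [\int u <= \int v]: the difference [v - u] is nonnegative
    almost everywhere and has zero integral.  The bound on [`|u|], rather than on
    [u] alone, makes [u] integrable. *)
Lemma ae_eq_of_Rintegral (u v : X -> R) :
  measurable_fun setT u -> mu.-integrable setT (EFin \o v) ->
  {ae mu, forall x, `|u x| <= v x} ->
  \int[mu]_x u x = \int[mu]_x v x -> {ae mu, forall x, u x = v x}.
Proof.
move=> mu_ iv uv uvE.
have mv : measurable_fun setT v by apply/measurable_EFinP; case/integrableP: iv.
have iu : mu.-integrable setT (EFin \o u).
  apply/integrableP; split; first exact/measurable_EFinP.
  case/integrableP: iv => _; apply: le_lt_trans.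
  apply: ae_ge0_le_integral => //.
  - by apply: measurableT_comp => //; exact/measurable_EFinP.
  - by apply: measurableT_comp => //; exact/measurable_EFinP.
  - by apply: filterS uv => x uvx _ /=; rewrite lee_fin (le_trans uvx)// ler_norm.
have mvu : measurable_fun setT (fun x => (v x - u x)%:E).
  by apply/measurable_EFinP; exact: measurable_funB.
have int0 : (\int[mu]_x `|(v x - u x)%:E| = 0)%E.
  rewrite -(@ae_eq_integral _ _ _ mu setT _ (fun x => (v x - u x)%:E))//.
  - under eq_integral do rewrite EFinB.
    rewrite integralB_EFin// -[X in (X - _)%E]fineK ?integrable_fin_num//.
    rewrite -[X in (_ - X)%E]fineK ?integrable_fin_num//.
    by rewrite -[fine _]/(\int[mu]_x v x) -[X in (_ - X%:E)%E]/(\int[mu]_x u x) uvE subee.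
  - exact: measurableT_comp.
  - apply: filterS uv => x uvx _; rewrite /= ger0_norm// subr_ge0.
    by rewrite (le_trans _ uvx)// ler_norm.
have /(ae_eq_integral_abs mu measurableT mvu) := int0.
by apply: filterS => x /(_ I) [] /eqP; rewrite subr_eq0 => /eqP.
Qed.

End kintegral_norm.

(** * Functionals norming an integrable function *)

Section norming_functionals.
Context d (X : measurableType d) (R : realType) (K : rclike R).
Variable mu : {measure set X -> \bar R}.
Implicit Types (f : L1 K mu) (h : Linfty K mu).

Lemma L1_norm_Rintegral f : `|f| = ofR K (\int[mu]_x re `|kLspace_fun f x|).
Proof. exact: L1_normE. Qed.

Lemma L1_norm_integrable f :
  mu.-integrable setT (fun x => (re `|kLspace_fun f x|)%:E).
Proof.
have [mf foo] := kLspace_mem f; apply/integrableP; split.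
  by apply/measurable_EFinP; exact: (kmeasurable_norm mf).
by move: foo; rewrite /kLnorm Lnorm1.
Qed.

(** If the whole space is null, any two functions agree almost everywhere.
    Positivity of the measure is what makes the norm of [Linfty] an essential
    supremum, and hence gives the constant function 1 norm 1. *)
Lemma L1_neq0_mu_gt0 f : f != 0 -> (0 < mu [set: X])%E.
Proof.
move=> f0; rewrite lt0e measure_ge0 andbT; apply: contra f0 => /eqP mu0.
by apply/eqP/kLspace_inj; exists setT; split.
Qed.

Lemma Linfty_ae_le1 h : (0 < mu [set: X])%E -> `|h| = 1 ->
  {ae mu, forall x, re `|kLspace_fun h x| <= 1}.
Proof.
move=> mu0; rewrite Linfty_normE// => h1.
have fin : ess_sup mu (fun x => (re `|kLspace_fun h x|)%:E) \is a fin_num.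
  have := kLnorm_fin h; rewrite /kLnorm unlock mu0.
  congr (_ \is a fin_num); congr (ess_sup mu _); apply/funext => x /=.
  by rewrite /knorm_fun ger0_norm ?re_norm_ge0.
have := ess_sup_ge mu (fun x => (re `|kLspace_fun h x|)%:E).
apply: filterS => x; rewrite -(fineK fin) lee_fin => /le_trans; apply.
by have := congr1 (@re R K) h1; rewrite re_ofR re1 => ->.
Qed.

Lemma Linfty_unimodular (u : X -> K) : (0 < mu [set: X])%E ->
  kmeasurable u -> (forall x, `|u x| = 1) ->
  exists h, `|h| = 1 /\ {ae mu, forall x, kLspace_fun h x = u x}.
Proof.
move=> mu0 mu_ u1.
have uL : (u : X -> K^o) \in kLfun mu (leey 1%E).
  apply/kLfunP; split=> //; rewrite /kLnorm unlock mu0.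
  rewrite (_ : (_ \o _) = cst 1%E) ?ess_sup_cst ?ltry//.
  by apply/funext => x /=; rewrite /knorm_fun u1 re1 normr1.
pose h : Linfty K mu := (\pi_(kLspace K mu (leey 1%E)) (KLfun uL))%qT.
have hu : {ae mu, forall x, kLspace_fun h x = u x} := kLspace_funP (KLfun uL).
exists h; split => //; rewrite Linfty_normE// (@ess_sup_ae_cst _ _ _ _ _ 1%E)//=.
  exact: ofR1.
by apply: filterS hu => x /= ->; rewrite u1 re1.
Qed.

(** The norm of [f] is attained by [h] exactly when the pointwise bound
    [|h f| <= |f|] is saturated with the right phase almost everywhere. *)
Lemma canonical_map_attains_norm f h : (0 < mu [set: X])%E -> `|h| = 1 ->
  canonical_map h f = `|f| <->
  {ae mu, forall x, kLspace_fun h x * kLspace_fun f x = `|kLspace_fun f x|}.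
Proof.
move=> mu0 h1; rewrite L1_norm_Rintegral /canonical_map.
have [mf _] := kLspace_mem f; have [mh _] := kLspace_mem h.
have mhf := kmeasurable_mul mh mf; split; last exact: kintegral_ae_norm.
move/(congr1 (@re R K)); rewrite re_kintegral re_ofR => intE.
have le1 := Linfty_ae_le1 mu0 h1.
have hf_le : {ae mu, forall x, re `|kLspace_fun h x * kLspace_fun f x|
    <= re `|kLspace_fun f x|}.
  by apply: filterS le1 => x hx; rewrite re_normM ler_piMl ?re_norm_ge0.
have reE : {ae mu, forall x, re (kLspace_fun h x * kLspace_fun f x)
    = re `|kLspace_fun f x|}.
  apply: ae_eq_of_Rintegral => //; first exact: (proj1 mhf).
    exact: L1_norm_integrable.
  by apply: filterS hf_le => x; apply: le_trans; exact: norm_re_le.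
apply: filterS2 reE hf_le => x xE xle.
have nE : re `|kLspace_fun h x * kLspace_fun f x| = re `|kLspace_fun f x|.
  apply: le_anti; rewrite xle/= -xE.
  exact: le_trans (ler_norm _) (norm_re_le _).
by rewrite (re_eq_norm (etrans xE (esym nE))) -re_normK nE re_normK.
Qed.

End norming_functionals.

Theorem theorem3p0p3 (R : realType) (K : rclike R)
    (hK : K = real_scalars R \/ K = complex_scalars R)
    (d : measure_display) (X : measurableType d)
    (lambda : {measure set X -> \bar R})
    (hdual : L1_dual_is_Linfty K lambda)
    (f : L1 K lambda) (f_neq0 : f != 0) :
  smooth_point f <-> {ae lambda, forall x, kLspace_fun f x != 0}.
Proof.
have mu0 := L1_neq0_mu_gt0 f_neq0.
have [_ [maps inj surj] isom] := hdual.
have [mf _] := kLspace_mem f.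
(* Every unimodular filling of the zero set of f gives a norming functional. *)
have ext c : `|c| = 1 -> exists h : Linfty K lambda,
    norming f (canonical_map h) /\
    {ae lambda, forall x, kLspace_fun h x = phase c (kLspace_fun f x)}.
  move=> c1.
  have [h [h1 hE]] := Linfty_unimodular mu0 (kmeasurable_phase c mf)
    (fun x => norm_phase (kLspace_fun f x) c1).
  exists h; split=> //; split; [exact: maps|by rewrite isom|].
  apply/canonical_map_attains_norm => //.
  by apply: filterS hE => x ->; exact: phase_mul.
split=> [[_ [phi Jphi]]|fn0].
- have [h [nh hE]] := ext 1 (normr1 _).
  have [g [ng gE]] := ext (-1) (normrN1 _).
  have hg : h = g.
    by apply: inj; rewrite ?in_setT//; move: nh ng; rewrite Jphi /= => -> ->.
  (* Where f vanishes, h would be both 1 and -1. *)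
  subst g; apply: filterS2 hE gE => x -> /eqP; apply: contraL => /eqP fx0.
  rewrite /phase fx0 eqxx -subr_eq0 opprK.
  by rewrite (_ : 1 + 1 = 2%:R :> K)// pnatr_eq0.
- have [h [nh _]] := ext 1 (normr1 _).
  split=> //; exists (canonical_map h); apply/seteqP; split=> [psi|_ ->//].
  move=> [psiD psi1 psif] /=; have [g _ gE] := surj _ psiD.
  subst psi; congr canonical_map; apply: kLspace_inj.
  case: nh => _ h1 hf; rewrite !isom in psi1 h1.
  have /canonical_map_attains_norm-/(_ mu0 psi1) gE := psif.
  have /canonical_map_attains_norm-/(_ mu0 h1) hE := hf.
  apply: filterS3 fn0 gE hE => x fx0 gx hx.
  by apply: (mulIf fx0); rewrite gx hx.
Qed.
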